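(* The following conditions on $(s,n)\in\mathbb{C}\times\mathbb{Z}_{\ge0}$ are equivalent. (i) $\mathrm{Sol}_{\mathrm{I}}(s;n)\ne\{0\}$. (ii) One of the following holds: $n\equiv0\pmod4$ and $s\in\mathbb{C}$; $n\equiv1\pmod4$ and $s\in I_1$; $n\equiv2\pmod4$ and $s\in\mathbb{C}$; $n\equiv3\pmod4$ and $s\in I_3$. Moreover, for such $(s,n)$, the space $\mathrm{Sol}_{\mathrm{I}}(s;n)$ is given as follows. (1) $n\equiv0\pmod4$: $\mathrm{Sol}_{\mathrm I}(s;n)=\mathbb{C}u_{[s;n]}(t)$ if $s\in\mathbb{C}\setminus(I_0^+\cup I_0^-)$, and $\mathrm{Sol}_{\mathrm I}(s;n)=\mathbb{C}u_{[s;n]}(t)\oplus\mathbb{C}v_{[s;n]}(t)$ if $s\in I_0^+\cup I_0^-$. (2) $n\equiv1\pmod4$: $\mathrm{Sol}_{\mathrm I}(s;n)=\mathbb{C}u_{[s;n]}(t)\oplus\mathbb{C}v_{[s;n]}(t)$ for $s\in I_1$. (3) $n\equiv2\pmod4$: $\mathrm{Sol}_{\mathrm I}(s;n)=\mathbb{C}v_{[s;n]}(t)$ if $s\in\mathbb{C}\setminus(I_2^+\cup I_2^-)$, and $\mathrm{Sol}_{\mathrm I}(s;n)=\mathbb{C}u_{[s;n]}(t)\oplus\mathbb{C}v_{[s;n]}(t)$ if $s\in I_2^+\cup I_2^-$. (4) $n\equiv3\pmod4$: $\mathrm{Sol}_{\mathrm I}(s;n)=\mathbb{C}u_{[s;n]}(t)\oplus\mathbb{C}v_{[s;n]}(t)$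 for $s\in I_3$.
   Context: $\mathrm{Pol}_n[t]$ is the space of complex polynomials in $t$ of degree at most $n$. $\mathrm{Sol}_{\mathrm I}(s;n)$ is the space of $p(t)\in\mathrm{Pol}_n[t]$ satisfying $$(1-t^4)p''(t)+2\big((n-1)t^2+s\big)t\,p'(t)-n\big((n-1)t^2+s\big)p(t)=0$$ (this is the equation $-2\sqrt{-1}\,d\pi_n^{\mathrm I}(D_s^\flat)p=0$, where $d\pi^{\mathrm I}_n(D_s^\flat)=\frac{\sqrt{-1}}2d\pi_n\big((E_++E_-)(E_+-E_-)-(s-1)E_0\big)$ with $d\pi_n(E_+)=-\frac{d}{dt}$, $d\pi_n(E_-)=-nt+t^2\frac{d}{dt}$, $d\pi_n(E_0)=-2t\frac{d}{dt}+n$). $Hl(a,q;\alpha,\beta,\gamma,\delta;z)$ denotes the local Heun function, i.e. the power series solution at $z=0$ with constant term $1$ of Heun's equation $$f''(z)+\left(\frac\gamma z+\frac\delta{z-1}+\frac{\varepsilon}{z-a}\right)f'(z)+\frac{\alpha\beta z-q}{z(z-1)(z-a)}f(z)=0,\qquad \gamma+\delta+\varepsilon=\alpha+\beta+1,$$ and $$u_{[s;n]}(t)=Hl\left(-1,-\tfrac{ns}4;-\tfrac n2,-\tfrac{n-1}2,\tfrac12,\tfrac{1-n-s}2;t^2\right),$$ $$v_{[s;n]}(t)=t\,Hl\left(-1,-\tfrac{(n-2)s}4;-\tfrac{n-1}2,-\tfrac{n-2}2,\tfrac32,\tfrac{1-n-s}2;t^2\right).$$ Sets (depending on $n$; $[\cdot]$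 is the integer part): for $n\in4\mathbb{Z}_{\ge0}$, $I_0^\pm=\{\pm(3+4j):0\le j\le\frac n4-1\}$; and $I_1=\{\pm4j:0\le j\le[\frac n4]\}$, $I_2^\pm=\{\pm(1+4j):0\le j\le[\frac n4]\}$, $I_3=\{\pm(2+4j):0\le j\le[\frac n4]\}$. *)

(* Defs.v *)
From HB Require Import structures.
From mathcomp Require Import all_boot all_order all_algebra.
From mathcomp Require Import boolp classical_sets functions reals.
From mathcomp Require Import complex ring.

Set Implicit Arguments.
Unset Strict Implicit.
Unset Printing Implicit Defensive.

Import Order.TTheory GRing.Theory Num.Theory.

Local Open Scope classical_set_scope.
Local Open Scope ring_scope.

(* A formal power series is the sequence of its coefficients; addition and
   scaling are the pointwise ones of functions. *)
Notation fps K := (nat -> (K : nzRingType)^o).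

Section FormalPowerSeries.
Variable K : numFieldType.
Implicit Types (f g : fps K) (p : {poly K}).

Definition fps_poly p : fps K := fun k => p`_k.

Definition fps_mul f g : fps K := fun k => \sum_(i < k.+1) f i * g (k - i)%N.

Definition fps_deriv f : fps K := fun k => f k.+1 *+ k.+1.

(* f(t ^ 2) *)
Definition fps_sq f : fps K := fun k => if odd k then 0 else f k./2.

Lemma fps_poly_inj : injective fps_poly.
Proof. by move=> p q pq; apply/polyP => k; have := congr1 (@^~ k) pq. Qed.

Lemma fps_mulDl p q f k :
  fps_mul (fps_poly (p + q)) f k
  = fps_mul (fps_poly p) f k + fps_mul (fps_poly q) f k.
Proof.
rewrite /fps_mul /fps_poly -big_split /=.
by apply: eq_bigr => i _; rewrite coefD mulrDl.
Qed.

Lemma fps_mulC c f k : fps_mul (fps_poly c%:P) f k = c * f k.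
Proof.
rewrite /fps_mul /fps_poly big_ord_recl big1 ?addr0 ?coefC ?subn0 // => i _.
by rewrite coefC mul0r.
Qed.

Lemma fps_mulX p f k :
  fps_mul (fps_poly ('X * p)) f k
  = if k is j.+1 then fps_mul (fps_poly p) f j else 0.
Proof.
rewrite /fps_mul /fps_poly big_ord_recl coefXM mul0r add0r.
case: k => [|j]; first by rewrite big_ord0.
by apply: eq_bigr => i _; rewrite coefXM.
Qed.

End FormalPowerSeries.

Section Heun.
Variable K : numFieldType.
Implicit Types (f : fps K) (a q alpha beta gamma delta : K).

(* The left-hand side of Heun's equation multiplied by z (z - 1) (z - a), with
   epsilon = alpha + beta + 1 - gamma - delta. *)
Definition heun_op a q alpha beta gamma delta f : fps K :=
  let epsilon := alpha + beta + 1 - gamma - delta in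
  fps_mul (fps_poly ('X * ('X - 1) * ('X - a%:P))) (fps_deriv (fps_deriv f))
  + fps_mul (fps_poly (gamma *: (('X - 1) * ('X - a%:P))
                       + delta *: ('X * ('X - a%:P))
                       + epsilon *: ('X * ('X - 1)))) (fps_deriv f)
  + fps_mul (fps_poly ((alpha * beta) *: 'X - q%:P)) f.

Definition is_local_heun a q alpha beta gamma delta f : Prop :=
  heun_op a q alpha beta gamma delta f = 0 /\ f 0%N = 1.

(* The default value 0 is irrelevant when a != 0 and gamma is not a nonpositive
   integer: see [HlP] and [Hl_unique]. *)
Definition Hl a q alpha beta gamma delta : fps K :=
  xget 0 [set f | is_local_heun a q alpha beta gamma delta f].

Lemma heun_opE a q alpha beta gamma delta f k :
  heun_op a q alpha beta gamma delta f k =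
    a * k.+1%:R * (k%:R + gamma) * f k.+1
    - (k%:R * ((1 + a) * (k%:R - 1 + gamma) + delta * a
               + (alpha + beta + 1 - gamma - delta)) + q) * f k
    + (if k is j.+1 then (j%:R + alpha) * (j%:R + beta) * f j else 0).
Proof.
rewrite /heun_op; set ep := alpha + beta + 1 - gamma - delta.
rewrite -[LHS]/(fps_mul _ _ k + fps_mul _ _ k + fps_mul _ _ k).
have -> : 'X * ('X - 1) * ('X - a%:P)
  = 'X * ('X * ('X * 1%:P + (- (1 + a))%:P) + a%:P) + 0%:P :> {poly K}.
  by rewrite polyC1 polyC0 polyCN polyCD polyC1; ring.
have -> : gamma *: (('X - 1) * ('X - a%:P)) + delta *: ('X * ('X - a%:P))
    + ep *: ('X * ('X - 1))
  = 'X * ('X * (gamma + delta + ep)%:P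
          + (- (gamma * (1 + a) + delta * a + ep))%:P)
    + (gamma * a)%:P :> {poly K}.
  by rewrite -!mul_polyC polyCN !(polyCD, polyCM) polyC1; ring.
have -> : (alpha * beta) *: 'X - q%:P = 'X * (alpha * beta)%:P + (- q)%:P.
  by rewrite -mul_polyC polyCN; ring.
rewrite !(fps_mulDl, fps_mulX, fps_mulC) /fps_deriv /ep.
case: k => [|[|[|j]]]; rewrite ?(fps_mulDl, fps_mulX, fps_mulC) /=; by ring.
Qed.

Section WellDefined.
Variables (a q alpha beta gamma delta : K).
Hypotheses (a_neq0 : a != 0) (gamma_ok : forall k : nat, gamma != - k%:R).

Let A k : K := a * k.+1%:R * (k%:R + gamma).

Let A_neq0 k : A k != 0.
Proof.
by rewrite /A !mulf_neq0 // ?pnatr_eq0 // addrC -[k%:R]opprK subr_eq0.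
Qed.

Lemma Hl_exists : exists f, is_local_heun a q alpha beta gamma delta f.
Proof.
pose B (k : nat) : K := k%:R * ((1 + a) * (k%:R - 1 + gamma) + delta * a
               + (alpha + beta + 1 - gamma - delta)) + q.
pose D (j : nat) : K := (j%:R + alpha) * (j%:R + beta).
pose F := fix F k : K * K := if k is j.+1 then
  ((F j).2, (B j.+1 * (F j).2 - D j * (F j).1) / A j.+1)
  else (1, q / A 0).
exists (fun k => (F k).1); split=> //; apply/funext => k.
rewrite heun_opE -[RHS]/(0 : K) -/(A k) -/(B k).
have := A_neq0 k; case: k => [|j] An.
  by rewrite [A _ * _]mulrC /= divfK // mulr1 /B mul0r add0r subrr addr0.
by rewrite -/(D j) [A _ * _]mulrC /= divfK //; ring.
Qed.

Lemma local_heun_unique f g :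
  is_local_heun a q alpha beta gamma delta f ->
  is_local_heun a q alpha beta gamma delta g -> f = g.
Proof.
move=> [f_eq f0] [g_eq g0].
suff fg k : f k = g k /\ f k.+1 = g k.+1 by apply/funext => k; case: (fg k).
have step m : f m = g m -> (if m is j.+1 then f j = g j else True) ->
    f m.+1 = g m.+1.
  move=> fgm fgj; apply: (mulfI (A_neq0 m)).
  have := congr1 (@^~ m) (etrans f_eq (esym g_eq)).
  rewrite /= !heun_opE fgm.
  by case: m fgj {fgm} => [_|j ->] /addIr/addIr.
elim: k => [|k [fgk fgk1]].
  by rewrite f0 g0; split=> //; apply: step; rewrite ?f0 ?g0.
by split=> //; apply: step.
Qed.

Lemma HlP :
  is_local_heun a q alpha beta gamma delta (Hl a q alpha beta gamma delta).
Proof. exact: (@xgetPex _ _ [set f | _] Hl_exists). Qed.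

Lemma Hl_unique f :
  is_local_heun a q alpha beta gamma delta f ->
  f = Hl a q alpha beta gamma delta.
Proof. by move=> fP; apply: local_heun_unique HlP. Qed.

End WellDefined.

End Heun.

Section Solutions.
Variable K : numFieldType.
Implicit Types (s : K) (n : nat).

Definition Pol n : set {poly K} := [set p | (size p <= n.+1)%N].

Definition Sol_I s n : set {poly K} :=
  [set p | Pol n p /\
    (1 - 'X^4) * p^`()^`()
    + 2 * ((n%:R - 1) *: 'X^2 + s%:P) * 'X * p^`()
    - n%:R * ((n%:R - 1) *: 'X^2 + s%:P) * p = 0].

Definition u_ s n : fps K :=
  fps_sq (Hl (- 1) (- (n%:R * s / 4)) (- (n%:R / 2)) (- ((n%:R - 1) / 2))
             (1 / 2) ((1 - n%:R - s) / 2)).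

Definition v_ s n : fps K :=
  fps_mul (fps_poly 'X)
    (fps_sq (Hl (- 1) (- ((n%:R - 2) * s / 4)) (- ((n%:R - 1) / 2))
                (- ((n%:R - 2) / 2)) (3 / 2) ((1 - n%:R - s) / 2))).

(* j.+1 <= n %/ 4 is j <= n / 4 - 1; there is no such j for n = 0. *)
Definition I0_plus n : set K :=
  [set s | exists2 j, (j.+1 <= n %/ 4)%N & s = (3 + 4 * j)%N%:R].
Definition I0_minus n : set K :=
  [set s | exists2 j, (j.+1 <= n %/ 4)%N & s = - (3 + 4 * j)%N%:R].
Definition I1 n : set K :=
  [set s | exists2 j, (j <= n %/ 4)%N & s = (4 * j)%N%:R \/ s = - (4 * j)%N%:R].
Definition I2_plus n : set K :=
  [set s | exists2 j, (j <= n %/ 4)%N & s = (1 + 4 * j)%N%:R].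
Definition I2_minus n : set K :=
  [set s | exists2 j, (j <= n %/ 4)%N & s = - (1 + 4 * j)%N%:R].
Definition I3 n : set K :=
  [set s | exists2 j, (j <= n %/ 4)%N &
    s = (2 + 4 * j)%N%:R \/ s = - (2 + 4 * j)%N%:R].

Definition line (f : fps K) : set (fps K) := [set c *: f | c in [set: K]].

Definition is_direct_sum (V U W : set (fps K)) : Prop :=
  V = [set f + g | f in U & g in W] /\ U `&` W = [set 0].

(* Sol_I(s; n) = C f, resp. Sol_I(s; n) = C f (+) C g, inside power series in
   t: in particular f (and g) are polynomials. *)
Definition Sol_I_is_line s n (f : fps K) : Prop :=
  @fps_poly K @` Sol_I s n = line f.

Definition Sol_I_is_plane s n (f g : fps K) : Prop :=
  is_direct_sum (@fps_poly K @` Sol_I s n) (line f) (line g).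

End Solutions.

(* Main.v *)
Require Import Defs.
From mathcomp Require Import all_boot all_order all_algebra.
From mathcomp Require Import boolp classical_sets functions reals.
From mathcomp Require Import complex ring zify.

Set Implicit Arguments.
Unset Strict Implicit.
Unset Printing Implicit Defensive.

Import Order.TTheory GRing.Theory Num.Theory.

Local Open Scope classical_set_scope.
Local Open Scope ring_scope.

(** The operator of the equation is X Y - (s - 1) E_0 with X = E_+ + E_-,
Y = E_+ - E_-.  In the monomial basis it gives a three-term recurrence, but X
is diagonal in the basis e_a = (1 - t)^a (1 + t)^(n - a) of Pol_n, and both Y
and E_0 only shift the index a by one there.  With w_a = 2a + 1 - n one gets
  L e_a = a (w_(a-1) - s) e_(a-1) - (n - a) (w_a + s) e_(a+1),
so that p = sum_a b_a e_a solves L p = 0 if and only if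
  (a + 1) (w_a - s) b_(a+1) = (n - a + 1) (w_(a-1) + s) b_(a-1),
a two-term recurrence ([diff_op_cayley_eq0]) in which the coefficients of even
and of odd index are independent.  A coefficient of this recurrence vanishes
exactly when s or - s is some w_a: this is where the sets I_0, ..., I_3 come
from.  The change of basis is invertible because, up to the factor 2^n, the map
q |-> (1 + t)^n q((1 - t) / (1 + t)) is an involution ([cayleyK]).

On the other hand the recurrence in powers of t also preserves parity, and u
and v are its even and odd power series solutions normalized by their first
coefficient ([series_sol_decomp]).  Hence Sol_I is spanned by those of u and v
which are polynomials of degree at most n ([fps_poly_SolE]), and u, resp. v, is
one if and only if there is a nonzero even, resp. odd, polynomial solution.
Since t |-> - t exchanges e_a and e_(n-a), this says that the recurrence for b
has a nonzero solution with b_(n-a) = b_a, resp. b_(n-a) = - b_a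
([terminates_sym_sol]).

It remains to solve the two-term recurrence.  If n is odd, the reflection
a |-> n - a exchanges even and odd indices, and a nonzero solution exists if and
only if s = w_a for some even a ([sym_sol_odd]).  If n = 2M, the reflection
preserves the parity of the index.  One of the two signs always admits a
solution ([sym_sol_generic]); for the other sign the middle of the chain of
even indices forces zeros, which propagate unless s = w_a for an odd a >= M,
and the chain of odd indices vanishes unless s = w_a for an even a < M
([sym_sol_special]).  Conversely the first of these cases produces solutions
supported above the middle ([sym_sol_upper]), and the second one reduces to it
by the substitution t |-> i t, which changes s into - s ([terminates_opp]). *)

(** * The equation in the basis (1 - t)^a (1 + t)^(n - a) *)

Section Cayley.
Variable K : numFieldType.
Implicit Types (s : K) (n : nat) (p q : {poly K}).

(** The operator whose kernel in [Pol n] is [Sol_I s n]. *)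
Definition diff_op s n p : {poly K} :=
  (1 - 'X^4) * p^`()^`()
    + 2 * ((n%:R - 1) *: 'X^2 + s%:P) * 'X * p^`()
    - n%:R * ((n%:R - 1) *: 'X^2 + s%:P) * p.

Definition bin_basis (k m : nat) : {poly K} := (1 - 'X) ^+ k * (1 + 'X) ^+ m.

(** The eigenvalues of [E_+ + E_-] are [2 * a - n]; [weight n a] is the midpoint
    of two consecutive ones, that of index [a] and that of index [a + 1]. *)
Definition weight n (a : nat) : K := (2 * a + 1)%:R - n%:R.

Lemma one_minus_X_neq0 : (1 - 'X : {poly K}) != 0.
Proof. by rewrite -oppr_eq0 opprB -polyC1 polyXsubC_eq0. Qed.

Lemma one_plus_X_neq0 : (1 + 'X : {poly K}) != 0.
Proof. by rewrite addrC -polyC1 -size_poly_eq0 size_XaddC. Qed.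

(** Multiplying by [1 - 'X], resp. [1 + 'X], turns a neighbour of a basis element
    into a multiple of that element; the coefficient takes care of the end of
    the chain, where the neighbour does not exist. *)
Lemma bin_basis_lower k m :
  (1 - 'X) * (k%:R * bin_basis k.-1 m.+1) = k%:R * ((1 + 'X) * bin_basis k m).
Proof.
case: k => [|k]; first by rewrite !mul0r mulr0.
rewrite /bin_basis /= !exprS.
move: ((1 - 'X) ^+ k) ((1 + 'X) ^+ m) => A B.
by ring.
Qed.

Lemma bin_basis_raise k m :
  (1 + 'X) * (m%:R * bin_basis k.+1 m.-1) = m%:R * ((1 - 'X) * bin_basis k m).
Proof.
case: m => [|m]; first by rewrite !mul0r mulr0.
rewrite /bin_basis /= !exprS.
move: ((1 - 'X) ^+ k) ((1 + 'X) ^+ m) => A B.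
by ring.
Qed.

Lemma mul_exp_pred (x : {poly K}) k : x * (x ^+ k.-1 *+ k) = k%:R * x ^+ k.
Proof. by case: k => [|k]; rewrite ?mulr0n ?mulr0 ?mul0r // mulrnAr -exprS mulr_natl. Qed.

(** Basis elements have a rational logarithmic derivative with denominator
    [(1 - 'X) * (1 + 'X)]. *)
Lemma deriv_bin_basis k m :
  (1 - 'X) * (1 + 'X) * (bin_basis k m)^`()
  = (m%:R * (1 - 'X) - k%:R * (1 + 'X)) * bin_basis k m.
Proof.
rewrite /bin_basis derivM !deriv_exp !derivB !derivD derivX derivC sub0r add0r.
rewrite mul1r mulN1r mulNrn.
have := mul_exp_pred (1 - 'X) k; have := mul_exp_pred (1 + 'X) m.
move: ((1 - 'X) ^+ k.-1 *+ k : {poly K})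
  ((1 + 'X) ^+ m.-1 *+ m : {poly K}) => Ak Bm.
move: (1 - 'X : {poly K}) (1 + 'X : {poly K}) => P Q hQ hP.
transitivity (P * (Q * Bm) * P ^+ k - Q * (P * Ak) * Q ^+ m).
  by move: (P ^+ k) (Q ^+ m) => *; ring.
rewrite hQ hP; move: (P ^+ k) (Q ^+ m) => *; ring.
Qed.

Lemma deriv_natr n : (n%:R : {poly K})^`() = 0.
Proof. by rewrite -polyC_natr derivC. Qed.

(** The key computation.  After multiplication by [(1 - 'X) * (1 + 'X)], all the
    terms are polynomial multiples of the one basis element [bin_basis k m], and
    the identity reduces to one between their cofactors. *)
Lemma diff_op_bin_basis s k m (n := (k + m)%N) :
  diff_op s n (bin_basis k m)
  = k%:R * (weight n k.-1 - s)%:P * bin_basis k.-1 m.+1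
    - m%:R * (weight n k + s)%:P * bin_basis k.+1 m.-1.
Proof.
rewrite /diff_op.
have Ekw : k%:R * (weight n k.-1 - s)%:P = k%:R * ((2 * k)%:R - 1 - n%:R - s%:P) :> {poly K}.
  case: (k) => [|j]; first by rewrite !mul0r.
  by rewrite /weight /= polyCB polyCB !polyC_natr; ring.
have Emw : m%:R * (weight n k + s)%:P = m%:R * ((2 * k + 1)%:R - n%:R + s%:P) :> {poly K}.
  by rewrite /weight polyCD polyCB !polyC_natr; ring.
rewrite {}Ekw {}Emw -mul_polyC polyCB polyC1 !polyC_natr /n.
have E1 := deriv_bin_basis k m.
have E2 : (1 - 'X) * (1 + 'X) * (bin_basis k m)^`()^`() =
   - (k%:R + m%:R) * bin_basis k m
   + (m%:R * (1 - 'X) - k%:R * (1 + 'X) + 2 * 'X) * (bin_basis k m)^`().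
  have := congr1 (@deriv K) E1.
  rewrite !derivM !derivB !derivM !derivB !derivD !derivX !deriv_natr -polyC1 derivC polyC1.
  move: (bin_basis k m)^`()^`() (bin_basis k m)^`() (bin_basis k m) => d2 d1 e /eqP.
  rewrite -subr_eq0 => /eqP H; apply/eqP; rewrite -subr_eq0 -H; apply/eqP.
  by ring.
have EL := bin_basis_lower k m; have ER := bin_basis_raise k m.
apply: (mulfI one_minus_X_neq0); apply: (mulfI one_plus_X_neq0).
move: E1 E2 EL ER.
have -> : 'X^4 = ('X : {poly K}) * 'X * 'X * 'X by rewrite !exprS expr0; ring.
move: (bin_basis k m)^`()^`() => d2; move: (bin_basis k m)^`() => d1.
move: (bin_basis k.-1 _) (bin_basis k.+1 _) => eL eR.
move: (bin_basis k m) s%:P ('X : {poly K}) => e S X E1 E2 EL ER.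
rewrite natrD expr2.
have -> : (1 + X) * ((1 - X) *
   (k%:R * ((2 * k)%:R - 1 - (k%:R + m%:R) - S) * eL
    - m%:R * ((2 * k + 1)%:R - (k%:R + m%:R) + S) * eR))
  = (1 + X) * ((2 * k)%:R - 1 - (k%:R + m%:R) - S) * ((1 - X) * (k%:R * eL))
   - (1 - X) * ((2 * k + 1)%:R - (k%:R + m%:R) + S) * ((1 + X) * (m%:R * eR)) by ring.
rewrite EL ER.
transitivity ((1 - X) * (1 + X) * (1 + X * X) * ((1 - X) * (1 + X) * d2)
   + 2 * ((k%:R + m%:R - 1) * (X * X) + S) * X * ((1 - X) * (1 + X) * d1)
   - (1 - X) * (1 + X) * ((k%:R + m%:R) * ((k%:R + m%:R - 1) * (X * X) + S) * e)); first by ring.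
have -> : (1 - X) * (1 + X) * (1 + X * X) * ((1 - X) * (1 + X) * d2)
  = (1 + X * X) * ((1 - X) * (1 + X) * (- (k%:R + m%:R) * e)
    + (m%:R * (1 - X) - k%:R * (1 + X) + 2 * X) * ((1 - X) * (1 + X) * d1)).
  by rewrite E2; ring.
rewrite E1.
ring.
Qed.

(** This is [(1 + t) ^ n * q ((1 - t) / (1 + t))] for [q] of degree at most [n]:
    [q] collects the coordinates in the basis [bin_basis a (n - a)]. *)
Definition cayley n q : {poly K} :=
  \sum_(a < n.+1) q`_a *: bin_basis a (n - a).

(** Coordinate of index [a] of the image by [diff_op s n] of the polynomial with
    coordinates [q]. *)
Definition ladder s n q (a : nat) : K :=
  a.+1%:R * (weight n a - s) * q`_a.+1
  - (if a is j.+1 then (n%:R - j%:R) * (weight n j + s) * q`_j else 0).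

Lemma diff_opZ s n c p : diff_op s n (c *: p) = c *: diff_op s n p.
Proof.
by rewrite /diff_op !derivZ !(scalerBr, scalerDr) !scalerAr.
Qed.

Lemma diff_opD s n p q : diff_op s n (p + q) = diff_op s n p + diff_op s n q.
Proof.
rewrite /diff_op !derivD.
set A := 1 - 'X^4; set B := 2 * _ * 'X; set C := n%:R * _.
rewrite (mulrDr A) (mulrDr B) (mulrDr C) opprD.
by rewrite [X in X + _ = _]addrACA [LHS]addrACA.
Qed.

Lemma diff_op_sum s n m (F : 'I_m -> {poly K}) :
  diff_op s n (\sum_(i < m) F i) = \sum_(i < m) diff_op s n (F i).
Proof.
apply: (big_morph (diff_op s n) (@diff_opD s n)).
by have := diff_opZ s n 0 0; rewrite !scale0r.
Qed.

Lemma diff_op_cayley s n q : (size q <= n.+1)%N ->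
  diff_op s n (cayley n q) = cayley n (\poly_(a < n.+1) ladder s n q a).
Proof.
move=> sz_q; have qn : q`_n.+1 = 0 by rewrite nth_default.
pose L a : {poly K} := (a.+1%:R * (weight n a - s) * q`_a.+1) *: bin_basis a (n - a).
pose R j : {poly K} := ((n%:R - j%:R) * (weight n j + s) * q`_j) *: bin_basis j.+1 (n - j.+1).
transitivity (\sum_(a < n) L a - \sum_(j < n) R j).
  rewrite diff_op_sum.
  transitivity (\sum_(k < n.+1) ((if val k is a.+1 then L a else 0)
      - (if (k < n)%N then R k else 0))).
    apply: eq_bigr => -[k /= kn] _; rewrite diff_opZ.
    have {1}-> : n = (k + (n - k))%N by lia.
    rewrite diff_op_bin_basis subnKC 1?scalerBr; last by lia.
    rewrite -!polyC_natr -!polyCM !mul_polyC !scalerA; congr (_ - _).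
      case: k kn => [|k] kn; first by rewrite mul0r mulr0 scale0r.
      rewrite /L /= [q`__ * _]mulrC; congr (_ *: bin_basis _ _).
      by lia.
    case: ltnP => kn'; last by rewrite (_ : n - k = 0)%N ?mul0r ?mulr0 ?scale0r //; lia.
    rewrite /R natrB; last by lia.
    rewrite [q`__ * _]mulrC; congr (_ *: bin_basis _ _).
    by lia.
  rewrite sumrB big_ord_recl /= add0r; congr (_ - _).
  rewrite big_ord_recr /= ltnn addr0.
  by apply: eq_bigr => i _; rewrite ltn_ord.
transitivity (\sum_(a < n.+1) (L a - (if val a is j.+1 then R j else 0))).
  have Ln : L n = 0 by rewrite /L qn mulr0 scale0r.
  rewrite sumrB big_ord_recr /= Ln addr0.
  by rewrite [in RHS]big_ord_recl /= add0r.
apply: eq_bigr => -[a /= an] _; rewrite coef_poly an /ladder scalerBl.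
by case: a an => [|a] an; rewrite ?scale0r.
Qed.

Lemma size_bin_basis k m : (size (bin_basis k m) <= (k + m).+1)%N.
Proof.
have sz1 : (size (1 - 'X : {poly K})).-1 = 1%N by rewrite -opprB size_polyN -polyC1 size_XsubC.
have sz2 : (size (1 + 'X : {poly K})).-1 = 1%N by rewrite addrC -polyC1 size_XaddC.
have s1 := size_exp_leq (1 - 'X : {poly K}) k.
have s2 := size_exp_leq (1 + 'X : {poly K}) m.
rewrite sz1 in s1; rewrite sz2 in s2.
have := size_mul_leq ((1 - 'X : {poly K}) ^+ k) ((1 + 'X) ^+ m).
rewrite -/(bin_basis k m); lia.
Qed.

Lemma size_cayley n q : (size (cayley n q) <= n.+1)%N.
Proof.
apply: (leq_trans (size_sum _ _ _)); apply/bigmax_leqP => -[a /= an] _.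
apply: (leq_trans (size_scale_leq _ _)).
by have := size_bin_basis a (n - a); lia.
Qed.

(** The evaluation formula gives [cayleyK] without any manipulation of binomial
    sums, since [x |-> (1 - x) / (1 + x)] is an involution. *)
Lemma horner_cayley n q (x : K) : (size q <= n.+1)%N -> 1 + x != 0 ->
  (cayley n q).[x] = (1 + x) ^+ n * q.[(1 - x) / (1 + x)].
Proof.
move=> sz_q x1; rewrite (horner_coef_wide _ sz_q) mulr_sumr /cayley horner_sum.
apply: eq_bigr => -[a /= an] _; rewrite hornerZ /bin_basis hornerM !horner_exp.
rewrite !hornerD hornerN hornerX -polyC1 hornerC.
have -> : (1 + x) ^+ n = (1 + x) ^+ a * (1 + x) ^+ (n - a) by rewrite -exprD subnKC.
have : (1 + x) ^+ a != 0 by rewrite expf_neq0.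
rewrite expr_div_n; move: ((1 + x) ^+ a) ((1 - x) ^+ a) => B A B0.
by field.
Qed.

Lemma poly_eq_except p q (a : K) : (forall x, x != a -> p.[x] = q.[x]) -> p = q.
Proof.
move=> pq; apply/eqP; rewrite -subr_eq0.
suff /eqP : (p - q) * ('X - a%:P) = 0 by rewrite mulf_eq0 polyXsubC_eq0 orbF.
apply/eqP; apply: contraT => nz.
set r := _ * _ in nz.
pose rs := [seq i%:R : K | i <- iota 0 (size r)].
have := max_poly_roots (rs := rs) nz; rewrite size_map size_iota ltnn => -> //.
  apply/allP => x _; rewrite /root /r hornerM !hornerE.
  by case: (eqVneq x a) => [->|/pq->]; rewrite subrr ?mulr0 ?mul0r.
by rewrite map_inj_uniq ?iota_uniq // => i j /eqP; rewrite eqr_nat => /eqP.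
Qed.

Lemma cayleyK n q : (size q <= n.+1)%N -> cayley n (cayley n q) = 2 ^+ n *: q.
Proof.
move=> sz_q; apply: (@poly_eq_except _ _ (-1)) => x xN1.
have x1 : 1 + x != 0 by rewrite addrC -[1]opprK subr_eq0.
have y1 : 1 + (1 - x) / (1 + x) = 2 / (1 + x) by field.
have y1_neq0 : 1 + (1 - x) / (1 + x) != 0 by rewrite y1 mulf_neq0 ?invr_eq0 // pnatr_eq0.
rewrite !horner_cayley ?size_cayley // y1 hornerZ mulrA -exprMn mulrC.
have -> : (1 - (1 - x) / (1 + x)) / (2 / (1 + x)) = x.
  field; by rewrite ?x1 ?pnatr_eq0.
by rewrite mulrC [_ * (2 / _)]mulrC divfK.
Qed.

Lemma cayley_inj n q : (size q <= n.+1)%N -> cayley n q = 0 -> q = 0.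
Proof.
move=> sz_q q0; have := cayleyK sz_q; rewrite q0.
rewrite /cayley big1 => [/esym/eqP|i _]; last by rewrite coef0 scale0r.
by rewrite scaler_eq0 expf_eq0 pnatr_eq0 andbF => /eqP.
Qed.

Lemma cayley_surj n p : (size p <= n.+1)%N ->
  exists2 q : {poly K}, (size q <= n.+1)%N & p = cayley n q.
Proof.
move=> sz_p; exists ((2 ^+ n)^-1 *: cayley n p).
  exact: leq_trans (size_scale_leq _ _) (size_cayley _ _).
have mobZ c (q : {poly K}) : cayley n (c *: q) = c *: cayley n q.
  rewrite /cayley scaler_sumr; apply: eq_bigr => i _.
  by rewrite coefZ scalerA.
rewrite mobZ cayleyK // scalerA mulVf ?scale1r //.
by rewrite expf_neq0 ?pnatr_eq0.
Qed.

(** The factor [n - j] makes the recurrence consistent with the truncation at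
    index [n]. *)
Lemma ladder_out s n q a : (size q <= n.+1)%N -> (n < a)%N -> ladder s n q a = 0.
Proof.
move=> sz_q; case: a => [|a] // an; rewrite /ladder.
rewrite [q`_a.+2]nth_default ?mulr0 ?sub0r; last by apply: (leq_trans sz_q); lia.
case: (ltnP n a) => an'; last by rewrite (_ : n = a) ?subrr ?mul0r ?mul0r ?oppr0 //; lia.
by rewrite nth_default ?mulr0 ?oppr0 //; apply: (leq_trans sz_q).
Qed.

Lemma diff_op_cayley_eq0 s n q : (size q <= n.+1)%N ->
  diff_op s n (cayley n q) = 0 <-> forall a, ladder s n q a = 0.
Proof.
move=> sz_q; rewrite diff_op_cayley //; split=> [/cayley_inj/polyP L0 a|L0].
  case: (leqP a n) => an; last exact: ladder_out.
  by have := L0 (size_poly _ _) a; rewrite coef_poly ltnS an coef0.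
by rewrite /cayley big1 // => i _; rewrite coef_poly L0 if_same scale0r.
Qed.

Definition flip n q : {poly K} := \poly_(a < n.+1) q`_(n - a).

(** The parity of a polynomial is read on its coordinates: [t |-> - t] exchanges
    the two factors of the basis elements. *)
Lemma flip_cayley n q : cayley n (flip n q) = cayley n q \Po (- 'X).
Proof.
rewrite /cayley raddf_sum /= (reindex_inj rev_ord_inj) /=.
apply: eq_bigr => -[a /= an] _.
rewrite coef_poly comp_polyZ subSS ltnS leq_subr subKn //; congr (_ *: _).
rewrite /bin_basis !rmorphM !rmorphXn /= !rmorphB !rmorphD /= !comp_polyX rmorph1.
by rewrite opprK mulrC.
Qed.

Lemma coef_comp_polyNX p k : (p \Po (- 'X))`_k = (-1) ^+ k * p`_k.
Proof.
rewrite -{1}[p]coefK poly_def raddf_sum /= coef_sum.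
transitivity (\sum_(i < size p) (if k == i then (-1) ^+ k * p`_k else 0)).
  apply: eq_bigr => i _; rewrite comp_polyZ rmorphXn /= comp_polyX coefZ.
  have -> : (- 'X) ^+ i = ((-1) ^+ i)%:P * 'X^i :> {poly K}.
    by rewrite [LHS]exprNn rmorph_sign.
  rewrite coefCM coefXn.
  by case: eqP => [->|_]; rewrite ?mulr1 ?mulr0 // mulrC.
rewrite -big_mkcond /=; case: (ltnP k (size p)) => kp.
  rewrite (big_pred1 (Ordinal kp)) // => i /=; exact: eq_sym.
rewrite big_pred0 ?nth_default ?mulr0 // => i.
by apply/eqP => ki; move: kp; rewrite ki leqNgt ltn_ord.
Qed.

End Cayley.

(** * The two-term recurrence and its symmetric solutions *)

Section Ladder.
Variable K : numFieldType.
Implicit Types (s : K) (n : nat) (p q : {poly K}).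

Lemma weight_inj n : injective (@weight K n).
Proof.
move=> a b /addIr/eqP; rewrite eqr_nat => /eqP; lia.
Qed.

Lemma weight_rev n a b : (a + b).+1 = n -> weight K n a = - weight K n b.
Proof. by move=> <-; rewrite /weight; ring. Qed.

Definition ladder_sol s n q : Prop :=
  (size q <= n.+1)%N /\ forall a, ladder s n q a = 0.

(** Coordinates of a nonzero solution that is even for [e = false] and odd for
    [e = true]. *)
Definition sym_sol s n (e : bool) : Prop :=
  exists q : {poly K}, [/\ ladder_sol s n q, q != 0 &
    forall a, (a <= n)%N -> q`_(n - a) = (-1) ^+ e * q`_a].

Lemma ladder_solD s n c q r :
  ladder_sol s n q -> ladder_sol s n r -> ladder_sol s n (q + c *: r).
Proof.
move=> [szq Lq] [szr Lr]; split=> [|a].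
  apply: (leq_trans (size_polyD _ _)); rewrite geq_max szq /=.
  exact: leq_trans (size_scale_leq _ _) szr.
have -> : ladder s n (q + c *: r) a = ladder s n q a + c * ladder s n r a.
  by case: a => [|a]; rewrite /ladder !coefD !coefZ; ring.
by rewrite Lq Lr mulr0 addr0.
Qed.

(** The equation of index [a] for the reflected sequence is the equation of index
    [n - a] for the sequence, because weights are antisymmetric. *)
Lemma ladder_sol_flip s n q : ladder_sol s n q -> ladder_sol s n (flip n q).
Proof.
move=> [szq Lq]; have sz_flip : (size (flip n q) <= n.+1)%N by exact: size_poly.
split=> // a; case: (leqP a n) => [an|]; last exact: ladder_out.
have qn : q`_n.+1 = 0 by rewrite nth_default.
rewrite -[RHS](Lq (n - a)%N) /ladder /flip !coef_poly.
case: a an => [|a] an; case: ltnP => // an'.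
- rewrite subn0; case: n an' {an Lq sz_flip szq} qn => // n _ qn.
  rewrite qn subSS subn0 (@weight_rev n.+1 n 0) //; ring.
- have -> : n = 0%N by lia.
  by move: qn; rewrite (_ : n = 0)%N ?subn0; [move=> ->|]; [ring|lia].
- rewrite coef_poly (_ : (a < n.+1)%N); last by lia.
  have -> : (n - a.+1)%N = (n - a.+2).+1 by lia.
  have -> : (n - a)%N = (n - a.+2).+2 by lia.
  rewrite (@weight_rev n (n - a.+2).+1 a); last by lia.
  rewrite (@weight_rev n (n - a.+2) a.+1); last by lia.
  by rewrite -[(n - a.+2).+2]/(2 + (n - a.+2))%N natrD natrB; [ring|lia].
- have En : n = a.+1 by lia.
  rewrite coef_poly En subnn subSnn (_ : (a < a.+2)%N) // (@weight_rev a.+1 0 a) //; ring.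
Qed.

Lemma flipE n q a : (a <= n)%N -> (flip n q)`_a = q`_(n - a).
Proof. by move=> an; rewrite coef_poly ltnS an. Qed.

(** A solution that is not supported symmetrically has a nonzero symmetrization
    for both signs. *)
Lemma sym_sol_of_coef s n q a e : ladder_sol s n q -> (a <= n)%N ->
  q`_a != 0 -> q`_(n - a) = 0 -> sym_sol s n e.
Proof.
move=> Sq an qa qna; exists (q + (-1) ^+ e *: flip n q); split.
- exact: ladder_solD Sq (ladder_sol_flip Sq).
- apply/eqP => /polyP/(_ a); move/eqP: qa.
  by rewrite coefD coefZ flipE // qna mulr0 addr0 coef0.
- move=> b bn; rewrite !coefD !coefZ !flipE // ?leq_subr // subKn //.
  by rewrite mulrDr mulrA -signr_addb addbb expr0 mul1r addrC.
Qed.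

(** A zero propagates upwards by steps of two as long as the leading coefficient
    of the recurrence does not vanish. *)
Lemma ladder_vanish s n q b : ladder_sol s n q ->
  (forall a, (b <= a)%N -> (a < n)%N -> odd a = ~~ odd b -> s <> weight K n a) ->
  q`_b = 0 -> forall a, (b <= a)%N -> odd a = odd b -> q`_a = 0.
Proof.
move=> [szq Lq] sw qb; elim/ltn_ind => a IH ba oab.
case: (eqVneq a b) => [-> //|ab].
have [c Ec] : exists c, a = c.+2 by exists (a - 2)%N; lia.
rewrite {a}Ec in IH ba oab ab *.
case: (leqP n c.+1) => cn; first by rewrite nth_default //; apply: (leq_trans szq).
have qc : q`_c = 0 by apply: IH; lia.
have := Lq c.+1; rewrite /ladder qc mulr0 subr0 => /eqP.
rewrite !mulf_eq0 pnatr_eq0 /= subr_eq0 => /orP[/eqP w|/eqP //].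
by case: (sw c.+1); rewrite ?w //; lia.
Qed.

(** At index [0] the recurrence has a single term, so that the chain of odd
    indices starts with a zero unless [s] is the lowest weight. *)
Lemma ladder_start s n q : ladder_sol s n q ->
  (0 < n -> s <> weight K n 0)%N -> q`_1 = 0.
Proof.
move=> [szq Lq] sw; case: (posnP n) => n0.
  by rewrite nth_default //; apply: (leq_trans szq); rewrite n0.
have := Lq 0%N; rewrite /ladder subr0 mul1r => /eqP.
by rewrite mulf_eq0 subr_eq0 => /orP[/eqP w|/eqP //]; case: (sw n0).
Qed.

(** A chain may start at [b] either because there is nothing below [b], or
    because the equation of index [b - 1] does not involve the value at [b]; it is
    then solved upwards, and reaches [n] exactly by the parity condition. *)
Lemma ladder_sol_exists s n b : (b <= n)%N -> odd b = odd n ->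
  (b = 0 \/ s = weight K n b.-1)%N ->
  (forall a, (b < a)%N -> (a < n)%N -> odd a = ~~ odd b -> s <> weight K n a) ->
  exists q : {poly K}, [/\ ladder_sol s n q, q`_b = 1,
    forall a, (a < b)%N -> q`_a = 0 & forall a, odd a = ~~ odd b -> q`_a = 0].
Proof.
move=> bn obn sb sw.
pose up a := (n%:R - a%:R) * (weight K n a + s) : K.
pose down a := a.+1%:R * (weight K n a - s) : K.
(* [g j] is the value at [b + 2 * j] forced by the recurrence. *)
pose g i := \prod_(j < i) (up (b + 2 * j)%N / down (b + 2 * j).+1).
pose c a := if (b <= a)%N && ~~ odd (a - b) then g (a - b)./2 else 0.
pose q := \poly_(a < n.+1) c a.
have cb a : (a < b)%N -> c a = 0 by rewrite /c ltnNge => /negPf->.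
have co a : odd a = ~~ odd b -> c a = 0.
  by rewrite /c => oa; case: ifP => // ; lia.
have qc a : (a <= n)%N -> q`_a = c a by rewrite coef_poly ltnS => ->.
have q0 a : c a = 0 -> q`_a = 0 by rewrite coef_poly => ->; rewrite if_same.
exists q; split; last 2 first.
- by move=> a /cb/q0.
- by move=> a /co/q0.
- have szq : (size q <= n.+1)%N by exact: size_poly.
  split=> // a; case: (leqP a n) => an; last exact: ladder_out.
  case: (ltngtP a.+1 b) => ab.
  + rewrite /ladder q0 ?cb // mulr0 sub0r.
    by case: a ab {an} => [|a] ab; rewrite ?oppr0 // q0 ?mulr0 ?oppr0 // cb //; lia.
  + case: (boolP (odd a == odd b)) => [/eqP|] oab.
      rewrite /ladder q0 ?mulr0 ?sub0r; last by apply: co; rewrite /= oab.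
      case: a ab oab {an} => [|a] ab oab; rewrite ?oppr0 //.
      by rewrite q0 ?mulr0 ?oppr0 // co //; move: oab => /= <-; rewrite negbK.
    have [j Ej] : exists j, a = (b + 2 * j).+1.
      by exists (a - b)./2; lia.
    have an' : (a < n)%N by lia.
    rewrite /ladder Ej !qc; [|lia|lia].
    have E1 : (b <= b + 2 * j)%N && ~~ odd (b + 2 * j - b) by lia.
    have E2 : (b <= (b + 2 * j).+2)%N && ~~ odd ((b + 2 * j).+2 - b) by lia.
    rewrite /c E1 E2.
    have -> : ((b + 2 * j).+2 - b)./2 = j.+1 by lia.
    have -> : ((b + 2 * j) - b)./2 = j by lia.
    rewrite /g big_ord_recr /= -/(g j) -/(down (b + 2 * j).+1) -/(up (b + 2 * j)%N).
    have : down (b + 2 * j).+1 != 0.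
      rewrite mulf_neq0 ?pnatr_eq0 // subr_eq0 eq_sym; apply/eqP.
      by apply: sw; lia.
    by move: (g j) (up _) (down _) => G U D D0; field.
  + have sa : s = weight K n a by case: sb; [lia|move=> ->; rewrite -ab].
    rewrite /ladder -sa subrr mulr0 mul0r sub0r.
    case: a ab {an sa} => [|a] ab; rewrite ?oppr0 //.
    by rewrite q0 ?mulr0 ?oppr0 // cb //; lia.
- by rewrite qc // /c leqnn subnn /= /g big_ord0.
Qed.

(** Here [a |-> n - a] exchanges the two parities of indices: odd indices
    determine the solution, and their chain can only start right after an even
    [a] with [s = weight n a]. *)
Lemma sym_sol_odd s n e : odd n ->
  sym_sol s n e <-> exists2 i, (2 * i <= n)%N & s = weight K n (2 * i).
Proof.
move=> n_odd; split.
  move=> [q [Sq q_neq0 q_sym]]; apply: contrapT => no_i.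
  have sw a : (a <= n)%N -> ~~ odd a -> s <> weight K n a.
    by move=> an oa sa; apply: no_i; exists a./2; rewrite ?sa; [lia|congr weight; lia].
  have q1 : q`_1 = 0 by apply: (ladder_start Sq) => _; exact: sw.
  have q_odd a : odd a -> q`_a = 0.
    by move=> oa; apply: (ladder_vanish Sq _ q1); rewrite ?oa //;
       [move=> b b1 bn ob; apply: sw; lia|lia].
  move/eqP: q_neq0; apply; apply/polyP => a; rewrite coef0.
  case: (boolP (odd a)) => oa; first exact: q_odd.
  case: (leqP a n) => an.
    by rewrite -(subKn an) q_sym ?leq_subr // q_odd ?mulr0 // oddB // n_odd.
  by case: Sq => szq _; rewrite nth_default //; apply: (leq_trans szq).
move=> [i i_le si].
have [|||| q [Sq q1 _ q_even]] := @ladder_sol_exists s n (2 * i).+1.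
- by lia.
- by lia.
- by right.
- by move=> a ia _ _; rewrite si => /weight_inj; lia.
apply: (@sym_sol_of_coef _ _ q (2 * i).+1) => //; rewrite ?q1 ?oner_neq0 //; [lia|].
by apply: q_even; lia.
Qed.

Section EvenDegree.
Variables (s : K) (n : nat).
Hypothesis n_even : ~~ odd n.

(** For this sign the middle of the chain of even indices vanishes: if [n./2] is
    even, the middle index is sent to itself with a sign; if [n./2] is odd, the
    two terms of the equation of middle index coincide, so that each is zero
    (this is where [s <> weight K n n./2] is used).  The zero then propagates
    upwards, and symmetry settles the lower half. *)
Lemma sym_even_vanish e q : ladder_sol s n q -> e = ~~ odd n./2 ->
  (forall a, (a <= n)%N -> q`_(n - a) = (-1) ^+ e * q`_a) ->
  (forall a, (n <= 2 * a)%N -> (a < n)%N -> odd a -> s <> weight K n a) ->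
  forall a, ~~ odd a -> q`_a = 0.
Proof.
move=> Sq ee q_sym sw; set M := n./2 in ee.
have En : n = (2 * M)%N by rewrite /M; lia.
(* [b] is the first even index not below the middle. *)
pose b := (M + odd M)%N.
have qb : q`_b = 0.
  rewrite /b; case: (boolP (odd M)) ee => oM ee; last first.
    have := q_sym M; rewrite ee addn0 En mul2n -addnn addnK leq_addr.
    rewrite expr1 mulN1r => /(_ isT)/eqP; rewrite -addr_eq0 -mulr2n.
    by rewrite mulrn_eq0 => /eqP.
  have := q_sym M.+1; rewrite ee expr0 mul1r => /(_ ltac:(lia)).
  have -> : (n - M.+1 = M.-1)%N by lia.
  move=> qM; have := Sq.2 M; rewrite /ladder addn1.
  have [m Em] : exists m, M = m.+1 by exists M.-1; lia.
  rewrite Em /= in qM *; rewrite qM (@weight_rev n m m.+1); last by lia.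
  move=> H; suff /eqP : 2 * (m.+2%:R * (weight K n m.+1 - s)) * q`_m.+2 = 0.
    rewrite !mulf_eq0 !pnatr_eq0 /= subr_eq0 => /orP[/eqP w|/eqP //].
    by case: (sw m.+1); rewrite ?w //; lia.
  rewrite -[RHS]H En Em; ring.
have b_even : ~~ odd b by rewrite /b; lia.
have hi a : (b <= a)%N -> ~~ odd a -> q`_a = 0.
  move=> ba oa; apply: (ladder_vanish Sq _ qb) => //; last by lia.
  by move=> c bc cn oc; apply: sw; lia.
move=> a oa; case: (leqP b a) => ab; first exact: hi.
rewrite -(@subKn a n); last by lia.
by rewrite q_sym ?leq_subr // hi ?mulr0 //; lia.
Qed.

(** The chain of odd indices starts with a zero, which has to be propagated up to
    the middle only: symmetry does the rest. *)
Lemma sym_odd_vanish e q : ladder_sol s n q -> e = ~~ odd n./2 ->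
  (forall a, (a <= n)%N -> q`_(n - a) = (-1) ^+ e * q`_a) ->
  (forall a, (2 * a < n)%N -> ~~ odd a -> s <> weight K n a) ->
  forall a, odd a -> q`_a = 0.
Proof.
move=> Sq ee q_sym sw.
have lo a : (2 * a <= n)%N -> odd a -> q`_a = 0.
  elim/ltn_ind: a => -[|[|a]] IH an oa //.
    by apply: (ladder_start Sq) => n0; apply: sw; lia.
  have qa : q`_a = 0 by apply: IH; lia.
  have := Sq.2 a.+1; rewrite /ladder qa mulr0 subr0 => /eqP.
  rewrite !mulf_eq0 pnatr_eq0 /= subr_eq0 => /orP[/eqP w|/eqP //].
  by case: (sw a.+1); rewrite ?w //; lia.
move=> a oa; case: (leqP (2 * a) n) => an; first exact: lo.
case: (leqP a n) => an'; last first.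
  by case: Sq => szq _; rewrite nth_default //; apply: (leq_trans szq).
rewrite -(subKn an') q_sym ?leq_subr // lo ?mulr0 //; lia.
Qed.

Lemma sym_sol_special : sym_sol s n (~~ odd n./2) ->
  (exists a, [/\ odd a, (n <= 2 * a)%N, (a < n)%N & s = weight K n a]) \/
  (exists a, [/\ ~~ odd a, (2 * a < n)%N & s = weight K n a]).
Proof.
move=> [q [Sq q_neq0 q_sym]]; apply: contrapT => /not_orP[no_odd no_even].
move/eqP: q_neq0; apply; apply/polyP => a; rewrite coef0.
case: (boolP (odd a)) => oa.
  apply: (sym_odd_vanish Sq erefl q_sym) => // b bn ob sb.
  by apply: no_even; exists b.
apply: (sym_even_vanish Sq erefl q_sym) => // b bn nb ob sb.
by apply: no_odd; exists b.
Qed.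

(** The chain starting right after [a] is supported strictly above the middle. *)
Lemma sym_sol_upper a e : odd a -> (n <= 2 * a)%N -> (a < n)%N ->
  s = weight K n a -> sym_sol s n e.
Proof.
move=> oa na an sa.
have [|||| q [Sq q1 q_lo _]] := @ladder_sol_exists s n a.+1.
- by lia.
- by lia.
- by right.
- by move=> b ab _ _; rewrite sa => /weight_inj; lia.
apply: (@sym_sol_of_coef _ _ q a.+1) => //; rewrite ?q1 ?oner_neq0 //.
by apply: q_lo; lia.
Qed.

(** The chain of even indices has one more unknown than equations, hence a
    nonzero solution.  If its symmetrization for the sign considered were zero,
    it would be symmetric for the other sign, hence zero by [sym_even_vanish];
    the parameters excluded there are covered by [sym_sol_upper]. *)
Lemma sym_sol_generic : sym_sol s n (odd n./2).
Proof.
have [[a [oa na an sa]]|no_odd] :=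
  pselect (exists a, [/\ odd a, (n <= 2 * a)%N, (a < n)%N & s = weight K n a]).
  exact: sym_sol_upper sa.
(* The chain starts above the last index where the recurrence degenerates. *)
have [b [bn ob sb swb]] : exists b, [/\ (b <= n)%N, ~~ odd b,
    (b = 0 \/ s = weight K n b.-1)%N &
    forall a, (b < a)%N -> (a < n)%N -> odd a -> s <> weight K n a].
  have [[a [oa an sa]]|no] := pselect (exists a, [/\ odd a, (a < n)%N & s = weight K n a]).
    exists a.+1; split=> //; [by rewrite /= oa|by right|].
    by move=> c ac _ _; rewrite sa => /weight_inj; lia.
  exists 0%N; split=> //; first by left.
  by move=> a _ an oa sa; apply: no; exists a.
have [||||q [Sq q1 _ q_odd]] := @ladder_sol_exists s n b.
- by [].
- by rewrite (negPf ob) (negPf n_even).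
- by [].
- by move=> a ba an; rewrite (negPf ob); exact: swb.
pose r := q + (-1) ^+ odd n./2 *: flip n q.
have Sr : ladder_sol s n r by exact: ladder_solD Sq (ladder_sol_flip Sq).
exists r; split=> //.
  apply/eqP => r0.
  suff /eqP : q`_b = 0 by rewrite q1 oner_eq0.
  apply: (sym_even_vanish (e := ~~ odd n./2) Sq erefl) => //.
    move=> a an; have /polyP/(_ (n - a)%N) := r0.
    rewrite coefD coefZ flipE ?leq_subr // subKn // coef0 => /eqP.
    rewrite addr_eq0 => /eqP->.
    by rewrite -mulNr; case: (odd _); rewrite ?expr0 ?expr1 ?opprK.
  by move=> a na an oa sa; apply: no_odd; exists a.
move=> a an; rewrite /r !coefD !coefZ !flipE // ?leq_subr // subKn //.
by rewrite mulrDr mulrA -signr_addb addbb expr0 mul1r addrC.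
Qed.

End EvenDegree.
End Ladder.

(** * Power series solutions *)

Section PowerSeries.
Variable K : numFieldType.
Implicit Types (s : K) (n : nat) (p q : {poly K}) (f g : fps K).

(** Coefficients of the image by [diff_op s n] of a power series in [t]. *)
Definition series_op s n f (k : nat) : K :=
  (k.+2 * k.+1)%:R * f k.+2 + s * ((2 * k)%:R - n%:R) * f k
  - (if k is j.+2 then (n%:R - j%:R) * (n%:R - 1 - j%:R) * f j else 0).

Definition series_sol s n f : Prop := forall k, series_op s n f k = 0.

Lemma coef_diff_op s n p k :
  (diff_op s n p)`_k = series_op s n (fps_poly p) k.
Proof.
have -> : diff_op s n p = p^`()^`() - 'X^4 * p^`()^`()
    + (2 * (n%:R - 1))%:P * ('X^3 * p^`()) + (2 * s)%:P * ('X * p^`())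
    - (n%:R * (n%:R - 1))%:P * ('X^2 * p) - (n%:R * s)%:P * p.
  rewrite /diff_op -mul_polyC !(polyCM, polyCB, polyC_natr) polyC1.
  have -> : 'X^4 = ('X : {poly K}) * 'X * 'X * 'X by rewrite !exprS expr0; ring.
  have -> : 'X^3 = ('X : {poly K}) * 'X * 'X by rewrite !exprS expr0; ring.
  rewrite expr2; move: p^`()^`() p^`() s%:P ('X : {poly K}) => d2 d1 S X.
  by ring.
rewrite !(coefD, coefN) !coefCM !coefXnM coefXM !coef_deriv.
rewrite /series_op /fps_poly.
case: k => [|[|[|[|k]]]] /=; rewrite ?subSS ?subn0 ?subnn ?coef_deriv; ring.
Qed.

Lemma series_sol_unique s n f g : series_sol s n f -> series_sol s n g ->
  f 0%N = g 0%N -> f 1%N = g 1%N -> f = g.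
Proof.
move=> Sf Sg fg0 fg1.
suff fg k : f k = g k /\ f k.+1 = g k.+1 by apply/funext => k; case: (fg k).
have step m : f m = g m -> (if m is j.+2 then f j = g j else True) -> f m.+2 = g m.+2.
  move=> fgm fgj; have m_neq0 : (m.+2 * m.+1)%:R != 0 :> K by rewrite pnatr_eq0.
  apply: (mulfI m_neq0); have := etrans (Sf m) (esym (Sg m)).
  by rewrite /series_op fgm; case: m fgj {fgm m_neq0} => [|[|j]] => [_|_|->] /addIr/addIr.
elim/ltn_ind: k => -[|k] IH //.
have [fgk fgk1] := IH k (ltnSn k); split=> //; apply: step => //.
by case: k IH {fgk fgk1} => [|[|k]] IH //; case: (IH k) => //; lia.
Qed.

Lemma series_solD s n c d f g : series_sol s n f -> series_sol s n g ->
  series_sol s n (c *: f + d *: g).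
Proof.
move=> Sf Sg k.
have -> : series_op s n (c *: f + d *: g) k = c * series_op s n f k + d * series_op s n g k.
  rewrite /series_op; have E j : (c *: f + d *: g) j = c * f j + d * g j by [].
  by rewrite !E; case: k => [|[|k]]; rewrite ?E; ring.
by rewrite Sf Sg !mulr0 addr0.
Qed.

(** The condition on [gamma] under which the local Heun function is defined. *)
Lemma half_neq_opp_nat m : odd m -> forall k : nat, m%:R / 2 != - k%:R :> K.
Proof.
move=> om k; apply/eqP => h.
have : m%:R + (2 * k)%:R = 0 :> K.
  have -> : m%:R = m%:R / 2 * 2 :> K by rewrite divfK ?pnatr_eq0.
  by rewrite h natrM; ring.
by move/eqP; rewrite -natrD pnatr_eq0; lia.
Qed.

(** Indexing [u_] and [v_] by their parity treats both cases at once. *)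
Definition basic (e : bool) s n : fps K := if e then v_ s n else u_ s n.

Definition Hl_even s n := Hl (- 1) (- (n%:R * s / 4)) (- (n%:R / 2))
  (- ((n%:R - 1) / 2)) (1 / 2) ((1 - n%:R - s) / 2).

Lemma u_E s n k : u_ s n k = if odd k then 0 else Hl_even s n k./2.
Proof. by []. Qed.

Definition Hl_odd s n := Hl (- 1) (- ((n%:R - 2) * s / 4)) (- ((n%:R - 1) / 2))
  (- ((n%:R - 2) / 2)) (3 / 2) ((1 - n%:R - s) / 2).

Lemma v_E s n k : v_ s n k = if odd k then Hl_odd s n k./2 else 0.
Proof.
rewrite /v_ -[in 'X](mulr1 'X) fps_mulX -polyC1; case: k => [|k] //.
rewrite fps_mulC mul1r /fps_sq /=; case: (boolP (odd k)) => // ok.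
by congr Hl; lia.
Qed.

Lemma N1_neq0 : (- 1 : K) != 0. Proof. by rewrite oppr_eq0 oner_eq0. Qed.

(** Heun's recurrence at [m] is the equation at [2 * m] divided by [- 4]; all the
    coefficients of odd index of [u_] are zero. *)
Lemma u_series_sol s n : series_sol s n (u_ s n).
Proof.
have [Heq _] := HlP (- (n%:R * s / 4)) (- (n%:R / 2)) (- ((n%:R - 1) / 2))
  ((1 - n%:R - s) / 2) N1_neq0 (half_neq_opp_nat (m := 1) isT).
move=> k; rewrite /series_op !u_E /= negbK.
case: (boolP (odd k)) => ok.
  case: k ok => [|[|k]] //= ok; first by rewrite !mulr0; ring.
  by rewrite u_E; move: ok; rewrite negbK => ->; rewrite !mulr0 addr0 subrr.
have -> : k = k./2.*2 by lia.
move: (k./2) => m {k ok}; have := congr1 (fun f : fps K => - 4 * f m) Heq.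
rewrite heun_opE -/(Hl_even s n) doubleK mulr0 => H; apply: etrans H.
case: m => [|m]; first by rewrite double0; field.
rewrite doubleS u_E odd_double doubleK -mul2n; by field.
Qed.

Lemma v_series_sol s n : series_sol s n (v_ s n).
Proof.
have [Heq _] := HlP (- ((n%:R - 2) * s / 4)) (- ((n%:R - 1) / 2)) (- ((n%:R - 2) / 2))
  ((1 - n%:R - s) / 2) N1_neq0 (half_neq_opp_nat (m := 3) isT).
move=> k; rewrite /series_op !v_E /= negbK.
case: (boolP (odd k)) => ok; last first.
  case: k ok => [|[|k]] //= ok; first by rewrite !mulr0; ring.
  by rewrite v_E; move: ok; rewrite negbK => /negPf->; rewrite !mulr0 addr0 subrr.
have -> : k = k./2.*2.+1 by lia.
move: (k./2) => m {k ok}; have := congr1 (fun f : fps K => - 4 * f m) Heq.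
rewrite heun_opE -/(Hl_odd s n) /= uphalf_double mulr0 => H; apply: etrans H.
case: m => [|m]; first by rewrite double0; field.
rewrite doubleS v_E /= odd_double uphalf_double /= -mul2n; by field.
Qed.

Lemma basic_series_sol e s n : series_sol s n (basic e s n).
Proof. by case: e; [exact: v_series_sol|exact: u_series_sol]. Qed.

Lemma basic_parity e s n k : odd k = ~~ e -> basic e s n k = 0.
Proof. by case: e => ok; rewrite /basic ?v_E ?u_E ok. Qed.

Lemma basic1 e s n : basic e s n e = 1.
Proof.
case: e; rewrite /basic ?v_E ?u_E /=.
  exact: (HlP _ _ _ _ N1_neq0 (half_neq_opp_nat (m := 3) isT)).2.
exact: (HlP _ _ _ _ N1_neq0 (half_neq_opp_nat (m := 1) isT)).2.
Qed.

Lemma series_sol_decomp s n f : series_sol s n f ->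
  f = f 0%N *: u_ s n + f 1%N *: v_ s n.
Proof.
move=> Sf; apply: (series_sol_unique Sf).
- exact: series_solD (u_series_sol s n) (v_series_sol s n).
- rewrite -[RHS]/(f 0%N * basic false s n false + f 1%N * basic true s n 0%N).
  by rewrite basic1 basic_parity // mulr1 mulr0 addr0.
- rewrite -[RHS]/(f 0%N * basic false s n 1%N + f 1%N * basic true s n true).
  by rewrite basic1 basic_parity // mulr1 mulr0 add0r.
Qed.
End PowerSeries.

(** * Polynomial solutions among the power series solutions *)

Section Solutions.
Variable K : numFieldType.
Implicit Types (s : K) (n : nat) (p q : {poly K}) (f g : fps K) (e : bool).

Lemma Sol_IE s n p :
  Sol_I s n p <-> (size p <= n.+1)%N /\ series_sol s n (fps_poly p).
Proof.
rewrite -[Sol_I s n p]/((size p <= n.+1)%N /\ diff_op s n p = 0).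
split=> -[szp] H; split=> //; first by move=> k; rewrite -coef_diff_op H coef0.
by apply/polyP => k; rewrite coef_diff_op H coef0.
Qed.

Lemma fps_poly_Sol s n f :
  (@fps_poly K @` Sol_I s n) f
  <-> series_sol s n f /\ forall k, (n < k)%N -> f k = 0.
Proof.
split=> [[p /Sol_IE[szp Sp] <-]|[Sf f0]].
  by split=> // k nk; rewrite /fps_poly nth_default //; apply: (leq_trans szp).
pose p := \poly_(k < n.+1) f k.
have pf : fps_poly p = f.
  apply/funext => k; rewrite /fps_poly coef_poly ltnS.
  by case: leqP => // /f0.
by exists p => //; apply/Sol_IE; rewrite pf; split=> //; exact: size_poly.
Qed.

Definition terminates s n e := forall k, (n < k)%N -> basic e s n k = 0.

(** As [u_] and [v_] have disjoint supports, [c *: u_ s n + d *: v_ s n] vanishes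
    beyond [n] only if both terms do. *)
Lemma fps_poly_SolE s n f :
  (@fps_poly K @` Sol_I s n) f <-> exists c d,
    [/\ f = c *: u_ s n + d *: v_ s n,
        c <> 0 -> terminates s n false & d <> 0 -> terminates s n true].
Proof.
split=> [/fps_poly_Sol[Sf f0]|[c [d [-> uT vT]]]].
  exists (f 0%N), (f 1%N); split; first exact: series_sol_decomp.
    move=> /eqP f0_neq0 k nk; case: (boolP (odd k)) => ok.
      exact: basic_parity.
    apply: (mulfI f0_neq0); rewrite mulr0 -(f0 _ nk) [in RHS](series_sol_decomp Sf).
    rewrite -[RHS]/(f 0%N * basic false s n k + f 1%N * basic true s n k).
    by rewrite (@basic_parity _ true) ?(negPf ok) // mulr0 addr0.
  move=> /eqP f1_neq0 k nk; case: (boolP (odd k)) => ok; last first.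
    by apply: basic_parity; rewrite (negPf ok).
  apply: (mulfI f1_neq0); rewrite mulr0 -(f0 _ nk) [in RHS](series_sol_decomp Sf).
  rewrite -[RHS]/(f 0%N * basic false s n k + f 1%N * basic true s n k).
  by rewrite (@basic_parity _ false) // mulr0 add0r.
apply/fps_poly_Sol; split.
  exact: series_solD (u_series_sol s n) (v_series_sol s n).
move=> k nk.
rewrite -[LHS]/(c * basic false s n k + d * basic true s n k).
have -> : c * basic false s n k = 0.
  by have [->|/eqP/uT->] := eqVneq c 0; rewrite ?mul0r ?mulr0.
by have [->|/eqP/vT->] := eqVneq d 0; rewrite ?mul0r ?mulr0 ?addr0.
Qed.

(** A solution of parity [e] is a multiple of [basic e s n], since it is
    determined by its coefficient of index [e]. *)
Lemma terminates_sym_sol s n e : terminates s n e <-> sym_sol s n e.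
Proof.
split=> [fT|[q [[szq Lq] q_neq0 q_sym]]].
  have /fps_poly_Sol[p Sp pf] :
      series_sol s n (basic e s n) /\ forall k, (n < k)%N -> basic e s n k = 0.
    by split=> //; exact: basic_series_sol.
  have [szp _] := (Sol_IE s n p).1 Sp; have [_ p_sol] := Sp.
  have [q szq pq] := cayley_surj szp.
  have p_sym : p \Po (- 'X) = (-1) ^+ e *: p.
    apply/polyP => k; rewrite coef_comp_polyNX coefZ.
    rewrite -[p`_k]/(fps_poly p k) pf; case: (eqVneq (odd k) e) => [<-|ke].
      by rewrite signr_odd.
    by rewrite basic_parity ?mulr0 //; move: ke; case: (odd k); case: (e).
  have fq : flip n q = (-1) ^+ e *: q.
    apply/eqP; rewrite -subr_eq0; apply/eqP; apply: (@cayley_inj _ n).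
      apply: (leq_trans (size_polyD _ _)); rewrite geq_max size_poly size_polyN.
      exact: leq_trans (size_scale_leq _ _) szq.
    rewrite -scaleNr; have -> : cayley n (flip n q + - (-1) ^+ e *: q)
        = cayley n (flip n q) + - (-1) ^+ e *: cayley n q.
      rewrite /cayley scaler_sumr -big_split; apply: eq_bigr => i _ /=.
      by rewrite coefD coefZ scalerDl scalerA.
    by rewrite flip_cayley -pq p_sym scaleNr subrr.
  exists q; split.
  - by split=> //; apply/diff_op_cayley_eq0 => //; rewrite -pq.
  - apply/eqP => q0; have : fps_poly p e = 0.
      by rewrite /fps_poly pq q0 /cayley big1 ?coef0 // => i _; rewrite coef0 scale0r.
    by rewrite pf basic1 => /eqP; rewrite oner_eq0.
  - by move=> a an; rewrite -flipE // fq coefZ.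
set p := cayley n q.
have szp : (size p <= n.+1)%N by exact: size_cayley.
have Sp : Sol_I s n p by split=> //; apply/diff_op_cayley_eq0.
have p_neq0 : p != 0 by apply: contraNneq q_neq0 => /(cayley_inj szq)/eqP.
have fq : flip n q = (-1) ^+ e *: q.
  apply/polyP => a; rewrite coefZ; case: (leqP a n) => an.
    by rewrite flipE // q_sym.
  by rewrite coef_poly ltnNge an /= nth_default ?mulr0 //; apply: (leq_trans szq).
have p_par k : odd k = ~~ e -> p`_k = 0.
  move=> ok; have := flip_cayley n q; rewrite fq => /polyP/(_ k).
  have -> : cayley n ((-1) ^+ e *: q) = (-1) ^+ e *: cayley n q.
    by rewrite /cayley scaler_sumr; apply: eq_bigr => i _; rewrite coefZ scalerA.
  have sgn_k : (-1) ^+ k = - (-1) ^+ e :> K by rewrite -signr_odd ok signrN.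
  rewrite coef_comp_polyNX coefZ -/p sgn_k mulNr => /eqP.
  by rewrite -addr_eq0 -mulr2n mulrn_eq0 mulf_eq0 signr_eq0 => /eqP.
have [_ Sf] := (Sol_IE s n p).1 Sp.
have pE : fps_poly p = p`_e *: basic e s n.
  rewrite {1}(series_sol_decomp Sf).
  have -> : fps_poly p 0%N = if e then 0 else p`_e.
    by rewrite /fps_poly; case: (e) (p_par) => // ->.
  have -> : fps_poly p 1%N = if e then p`_e else 0.
    by rewrite /fps_poly; case: (e) (p_par) => // ->.
  by case: e {fq p_par q_sym}; rewrite /basic scale0r ?addr0 ?add0r.
have pe_neq0 : p`_e != 0.
  apply: contraNneq p_neq0 => pe; apply/eqP/polyP => k.
  by rewrite -[LHS]/(fps_poly p k) pE pe scale0r coef0.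
move=> k nk; apply: (mulfI pe_neq0).
rewrite -[LHS]/((p`_e *: basic e s n) k) -pE mulr0.
by rewrite /fps_poly nth_default //; apply: (leq_trans szp).
Qed.

(** Up to a constant factor, the sequence [g] below is the series
    [basic e s n] evaluated at [i t], and this substitution changes [s] into
    [- s] in the equation. *)
Lemma terminates_opp s n e : terminates s n e -> terminates (- s) n e.
Proof.
move=> fT; pose g : fps K := fun k => (-1) ^+ k./2 * basic e s n k.
have Sg : series_sol (- s) n g.
  move=> k; have := congr1 (fun x => - (-1) ^+ k./2 * x) (basic_series_sol e s n k).
  rewrite mulr0 /series_op /g => H; apply: etrans H.
  case: k => [|[|k]] /=; rewrite ?exprS ?expr0; [ring|ring|].
  by move: ((-1) ^+ k./2) => x; ring.
suff gE : g = basic e (- s) n by move=> k nk; rewrite -gE /g fT ?mulr0.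
apply: (series_sol_unique Sg (basic_series_sol _ _ _)).
  rewrite /g expr0 mul1r; case: e {fT g Sg}; first by rewrite !basic_parity.
  by rewrite -[0%N]/(nat_of_bool false) !basic1.
rewrite /g expr0 mul1r; case: e {fT g Sg}; last by rewrite !basic_parity.
by rewrite -[1%N]/(nat_of_bool true) !basic1.
Qed.

Lemma Sol_I_neq0 s n :
  Sol_I s n <> [set 0] <-> terminates s n false \/ terminates s n true.
Proof.
split=> [Sn0|].
  apply: contrapT => /not_orP[noU noV]; apply: Sn0; apply/seteqP; split=> p /=.
    move=> Sp; have /fps_poly_SolE[c [d [pE cT dT]]] :
      (@fps_poly K @` Sol_I s n) (fps_poly p) by exists p.
    have c0 : c = 0 by apply: contrapT => /cT.
    have d0 : d = 0 by apply: contrapT => /dT.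
    apply: fps_poly_inj; rewrite pE c0 d0 !scale0r addr0.
    by apply/funext => k; rewrite /fps_poly coef0.
  move=> ->; apply/Sol_IE; rewrite size_poly0; split=> // k.
  rewrite /series_op /fps_poly !coef0.
  by case: k => [|[|k]]; rewrite ?coef0 !mulr0 ?addr0 ?subrr.
have H e : terminates s n e -> Sol_I s n <> [set 0].
  move=> fT S0; have /fps_poly_Sol[p] :
      series_sol s n (basic e s n) /\ forall k, (n < k)%N -> basic e s n k = 0.
    by split=> //; exact: basic_series_sol.
  rewrite S0 => -> /(congr1 (fun f : fps K => f e)) /eqP.
  by rewrite basic1 /fps_poly coef0 eq_sym oner_eq0.
by case; apply: H.
Qed.

Lemma Sol_I_is_line_u s n : terminates s n false -> ~ terminates s n true ->
  Sol_I_is_line s n (u_ s n).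
Proof.
move=> uT vT; apply/seteqP; split=> f.
  move=> /fps_poly_SolE[c [d [-> _ dT]]].
  have -> : d = 0 by apply: contrapT => /dT.
  by exists c => //; rewrite scale0r addr0.
move=> [c _ <-]; apply/fps_poly_SolE; exists c, 0.
by split=> //; rewrite scale0r addr0.
Qed.

Lemma Sol_I_is_line_v s n : ~ terminates s n false -> terminates s n true ->
  Sol_I_is_line s n (v_ s n).
Proof.
move=> uT vT; apply/seteqP; split=> f.
  move=> /fps_poly_SolE[c [d [-> cT _]]].
  have -> : c = 0 by apply: contrapT => /cT.
  by exists d => //; rewrite scale0r add0r.
move=> [d _ <-]; apply/fps_poly_SolE; exists 0, d.
by split=> //; rewrite scale0r add0r.
Qed.

Lemma Sol_I_is_plane_uv s n : terminates s n false -> terminates s n true ->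
  Sol_I_is_plane s n (u_ s n) (v_ s n).
Proof.
move=> uT vT; split; apply/seteqP; split=> f.
- move=> /fps_poly_SolE[c [d [-> _ _]]].
  by exists (c *: u_ s n); [exists c|exists (d *: v_ s n); [exists d|]].
- move=> [_ [c _ <-] [_ [d _ <-] <-]]; apply/fps_poly_SolE.
  by exists c, d; split.
- move=> [[c _ <-] [d _ cd]] /=.
  have := congr1 (fun h : fps K => h 0%N) cd.
  rewrite -[X in X = _]/(d * basic true s n 0%N).
  rewrite -[X in _ = X]/(c * basic false s n false) basic1 basic_parity //.
  by rewrite mulr0 mulr1 => <-; rewrite scale0r.
- by move=> ->; split; exists 0 => //; rewrite scale0r.
Qed.

End Solutions.

(** * The exceptional parameters *)

Section ExceptionalValues.
Variable K : numFieldType.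
Implicit Types (s : K) (n m : nat).

Lemma terminates_odd s n e : odd n ->
  terminates s n e <-> exists2 i, (2 * i <= n)%N & s = weight K n (2 * i).
Proof. by move=> n_odd; rewrite terminates_sym_sol; exact: sym_sol_odd. Qed.

(** As [n] is even, the reflection [a |-> n - 1 - a] sends the even [a] below the
    middle to the odd ones above it, and changes the sign of the weight. *)
Lemma terminates_special s n : ~~ odd n ->
  terminates s n (~~ odd n./2) <-> exists a,
    [/\ odd a, (n <= 2 * a)%N, (a < n)%N &
        s = weight K n a \/ s = - weight K n a].
Proof.
move=> n_even; split.
  move=> /terminates_sym_sol/(sym_sol_special n_even)[[a [oa na an sa]]|[a [oa an sa]]].
    by exists a; split=> //; left.
  exists (n - a.+1)%N; split; [lia|lia|lia|right].
  by rewrite -(@weight_rev _ _ a) //; lia.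
move=> [a [oa na an [sa|sa]]].
  exact/terminates_sym_sol/(sym_sol_upper n_even _ oa na an).
rewrite -[s]opprK; apply: terminates_opp; apply/terminates_sym_sol.
by apply: (sym_sol_upper n_even _ oa na an); rewrite sa opprK.
Qed.

Lemma weight_natE n a k : (2 * a + 1 = k + n)%N -> weight K n a = k%:R.
Proof. by move=> E; rewrite /weight E natrD addrK. Qed.

Lemma weight_oppE n a k : (2 * a + 1 + k = n)%N -> weight K n a = - k%:R.
Proof. by move=> <-; rewrite /weight natrD; ring. Qed.

Lemma I1P s n e : (n %% 4 = 1)%N -> I1 n s <-> terminates s n e.
Proof.
move=> n1; have n_odd : odd n by lia.
rewrite (terminates_odd _ _ n_odd); split=> [[j jn [->|->]]|[i i_le ->]].
- exists (n %/ 4 + j)%N; first by lia.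
  by apply/esym/weight_natE; lia.
- exists (n %/ 4 - j)%N; first by lia.
  by apply/esym/weight_oppE; lia.
- case: (leqP i (n %/ 4)) => i4.
    by exists (n %/ 4 - i)%N; [lia|right; apply: weight_oppE; lia].
  by exists (i - n %/ 4)%N; [lia|left; apply: weight_natE; lia].
Qed.

Lemma I3P s n e : (n %% 4 = 3)%N -> I3 n s <-> terminates s n e.
Proof.
move=> n3; have n_odd : odd n by lia.
rewrite (terminates_odd _ _ n_odd); split=> [[j jn [->|->]]|[i i_le ->]].
- exists (n %/ 4 + j.+1)%N; first by lia.
  by apply/esym/weight_natE; lia.
- exists (n %/ 4 - j)%N; first by lia.
  by apply/esym/weight_oppE; lia.
- case: (leqP i (n %/ 4)) => i4.
    by exists (n %/ 4 - i)%N; [lia|right; apply: weight_oppE; lia].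
  by exists (i - (n %/ 4).+1)%N; [lia|left; apply: weight_natE; lia].
Qed.

Lemma I0P s n : (n %% 4 = 0)%N ->
  (I0_plus n `|` I0_minus n) s <-> terminates s n true.
Proof.
move=> n0; have n_even : ~~ odd n by lia.
have -> : true = ~~ odd n./2 by lia.
rewrite (terminates_special _ n_even); split=> [[[j jn ->]|[j jn ->]]|[a [oa na an sa]]].
- exists (2 * (n %/ 4) + 1 + 2 * j)%N; split; [lia|lia|lia|left].
  by apply/esym/weight_natE; lia.
- exists (2 * (n %/ 4) + 1 + 2 * j)%N; split; [lia|lia|lia|right].
  by congr (- _); apply/esym/weight_natE; lia.
- pose j := (a - (2 * (n %/ 4) + 1))./2.
  have wa : weight K n a = (3 + 4 * j)%N%:R by apply: weight_natE; lia.
  by case: sa => ->; [left|right]; exists j; rewrite ?wa //; lia.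
Qed.

Lemma I2P s n : (n %% 4 = 2)%N ->
  (I2_plus n `|` I2_minus n) s <-> terminates s n false.
Proof.
move=> n2; have n_even : ~~ odd n by lia.
have -> : false = ~~ odd n./2 by lia.
rewrite (terminates_special _ n_even); split=> [[[j jn ->]|[j jn ->]]|[a [oa na an sa]]].
- exists (2 * (n %/ 4) + 1 + 2 * j)%N; split; [lia|lia|lia|left].
  by apply/esym/weight_natE; lia.
- exists (2 * (n %/ 4) + 1 + 2 * j)%N; split; [lia|lia|lia|right].
  by congr (- _); apply/esym/weight_natE; lia.
- pose j := (a - (2 * (n %/ 4) + 1))./2.
  have wa : weight K n a = (1 + 4 * j)%N%:R by apply: weight_natE; lia.
  by case: sa => ->; [left|right]; exists j; rewrite ?wa //; lia.
Qed.

Lemma terminates_generic s n : ~~ odd n -> terminates s n (odd n./2).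
Proof. by move=> n_even; apply/terminates_sym_sol/sym_sol_generic. Qed.

End ExceptionalValues.

Theorem theorem6p7 (R : realType) (s : R[i]) (n : nat) :
  (Sol_I s n <> [set 0] <->
     [\/ (n %% 4 = 0)%N,
         (n %% 4 = 1)%N /\ I1 n s,
         (n %% 4 = 2)%N |
         (n %% 4 = 3)%N /\ I3 n s])
  /\
  [/\ (n %% 4 = 0)%N ->
        (~ (I0_plus n `|` I0_minus n) s -> Sol_I_is_line s n (u_ s n))
        /\ ((I0_plus n `|` I0_minus n) s ->
              Sol_I_is_plane s n (u_ s n) (v_ s n)),
      (n %% 4 = 1)%N -> I1 n s ->
        Sol_I_is_plane s n (u_ s n) (v_ s n),
      (n %% 4 = 2)%N ->
        (~ (I2_plus n `|` I2_minus n) s -> Sol_I_is_line s n (v_ s n))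
        /\ ((I2_plus n `|` I2_minus n) s ->
              Sol_I_is_plane s n (u_ s n) (v_ s n)) &
      (n %% 4 = 3)%N -> I3 n s ->
        Sol_I_is_plane s n (u_ s n) (v_ s n)].
Proof.
have u0 : (n %% 4 = 0)%N -> terminates s n false.
  move=> n0; have n_even : ~~ odd n by lia.
  have -> : false = odd n./2 by lia.
  exact: terminates_generic.
have v2 : (n %% 4 = 2)%N -> terminates s n true.
  move=> n2; have n_even : ~~ odd n by lia.
  have -> : true = odd n./2 by lia.
  exact: terminates_generic.
split.
  rewrite Sol_I_neq0; split=> [uv|[/u0|[n1 /(I1P s false n1)]|/v2|[n3 /(I3P s false n3)]]];
    [|by left|by left|by right|by left].
  have : (n %% 4 < 4)%N by rewrite ltn_mod.
  case En: (n %% 4)%N => [|[|[|[|//]]]] _.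
  - exact: Or41.
  - by apply: Or42; split=> //; case: uv => [/(I1P s false En)|/(I1P s true En)].
  - exact: Or43.
  - by apply: Or44; split=> //; case: uv => [/(I3P s false En)|/(I3P s true En)].
split.
- move=> n0; rewrite (I0P s n0); split=> vT.
    exact: Sol_I_is_line_u (u0 n0) vT.
  exact: Sol_I_is_plane_uv (u0 n0) vT.
- move=> n1 I1s.
  by apply: Sol_I_is_plane_uv; [exact/(I1P s false n1)|exact/(I1P s true n1)].
- move=> n2; rewrite (I2P s n2); split=> uT.
    exact: Sol_I_is_line_v uT (v2 n2).
  exact: Sol_I_is_plane_uv uT (v2 n2).
- move=> n3 I3s.
  by apply: Sol_I_is_plane_uv; [exact/(I3P s false n3)|exact/(I3P s true n3)].
Qed.
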